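(* Let $k$ be a field, $m\geqslant 1$ an integer, $r_1,\ldots,r_m$ integers with $r_i>1$ for all $i$, and $$A=\frac{k[X_1,\ldots,X_m,Y,Z,T]}{(X_1^{r_1}\cdots X_m^{r_m}Y-F(X_1,\ldots,X_m,Z,T))},$$ where $F(X_1,\ldots,X_m,Z,T)=f(Z,T)+h(X_1,\ldots,X_m,Z,T)$ for some $0\neq f\in k[Z,T]$ and some $h\in(X_1,\ldots,X_m)k[X_1,\ldots,X_m,Z,T]$. Let $x_1,\ldots,x_m,y,z,t$ denote the images of $X_1,\ldots,X_m,Y,Z,T$ in $A$, and let $E=k[x_1,\ldots,x_m]$ and $B=k[x_1,\ldots,x_m,z,t]$. Suppose $\operatorname{DK}(A)=B$. If $\phi\in\operatorname{Aut}_k(A)$, then the following hold: (a) $\phi$ restricts to an automorphism of $E$ and to an automorphism of $B$. (b) For each $i$, $1\leqslant i\leqslant m$, there exists $j$, $1\leqslant j\leqslant m$, such that $\phi(x_i)=\lambda_jx_j$, where $\lambda_j\in k^{*}$, and $r_i=r_j$. (c) $\phi(I)=I$, where $I=\left(x_1^{r_1}\cdots x_m^{r_m},F(x_1,\ldots,x_m,z,t)\right)k[x_1,\ldots,x_m,z,t]$. Conversely, if $\phi\in\operatorname{End}_k(A)$ satisfies conditions (a) and (c), then (b) holds and $\phi\in\operatorname{Aut}_k(A)$.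
   Context: All rings are commutative with unity. $\operatorname{End}_k(A)$ and $\operatorname{Aut}_k(A)$ denote the sets of $k$-algebra endomorphisms and automorphisms of $A$; $B^{[1]}$ denotes a polynomial ring in one variable over $B$. Exponential maps: let $B$ be a $k$-algebra and $\phi:B\to B^{[1]}$ a $k$-algebra homomorphism; for an indeterminate $U$ over $B$ write $\phi_U:B\to B[U]$ for this map. $\phi$ is an exponential map on $B$ if (1) $\epsilon_0\phi_U=\mathrm{id}_B$, where $\epsilon_0:B[U]\to B$ is evaluation at $U=0$; and (2) $\phi_V\phi_U=\phi_{U+V}$, where $\phi_V:B\to B[V]$ is extended to a $k$-algebra homomorphism $B[U]\to B[U,V]$ by $\phi_V(U)=U$. Its ring of invariants is $B^{\phi}=\{b\in B\mid \phi(b)=b\}$. $\operatorname{EXP}(B)$ is the set of all exponential maps on $B$. The Derksen invariant $\operatorname{DK}(B)$ is the $k$-subalgebra of $B$ generated by all $b\in B^{\phi}$ with $\phi\in\operatorname{EXP}(B)$ and $B^{\phi}\subsetneqq B$. *)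

(* Defs.v *)
From HB Require Import structures.
From mathcomp Require Import all_boot all_order all_algebra.
From mathcomp Require Import boolp classical_sets functions.
From mathcomp Require Import mpoly.

Set Implicit Arguments.
Unset Strict Implicit.
Unset Printing Implicit Defensive.

Import GRing.Theory.

Local Open Scope classical_set_scope.
Local Open Scope ring_scope.

Section Algebras.
Variables (k : fieldType) (A : comAlgType k).

Definition gen_subalg (G : set A) : set A :=
  smallest (fun S : set A => GRing.subalg_closed (mem S)) G.

(* For a subalgebra S, the ideal of S (not of A) generated by a and b. *)
Definition gen_ideal2 (S : set A) (a b : A) : set A :=
  [set c | exists u v, [/\ S u, S v & c = u * a + v * b]].

(* A[U, V] is {poly {poly A}}, with V the inner variable ('X%:P) and U the
   outer one ('X).  The extension of phi_V to A[U] -> A[U, V] fixing U is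
   map_poly phi, and phi_{U+V} a is the image of phi a under U |-> U + V.
   {poly A} is not declared as a k-algebra: k-linearity of the ring morphism
   phi is expressed by its fixing the constants c%:A. *)
Definition exponential (phi : {rmorphism A -> {poly A}}) : Prop :=
  [/\ forall c : k, phi c%:A = (c%:A)%:P,
      forall a, (phi a).[0] = a
    & forall a, map_poly phi (phi a) = (phi a)^:P \Po ('X + 'X%:P)].

Definition exp_inv (phi : {rmorphism A -> {poly A}}) : set A :=
  [set a | phi a = a%:P].

Definition Derksen : set A :=
  gen_subalg [set a | exists phi : {rmorphism A -> {poly A}},
    [/\ exponential phi, exp_inv phi `<` setT & exp_inv phi a]].

(* phi ranges over k-algebra endomorphisms of A and S over subalgebras, so a
   bijective restriction S -> S is an automorphism of S. *)
Definition restricts_to_aut (phi : {lrmorphism A -> A}) (S : set A) : Prop :=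
  set_bij S S phi.

End Algebras.

(* k[X_1..X_m,Z,T] is {mpoly k[m + 2]}, the last two variables being Z, T;
   k[X_1..X_m,Y,Z,T] is {mpoly k[(m + 2).+1]}, with Y the last variable
   'X_ord_max, and mwiden is the inclusion of the former in the latter. *)
Section Presentation.
Variables (k : fieldType) (m : nat).

Definition varX (i : 'I_m) : {mpoly k[m + 2]} := 'X_(lshift 2 i).
Definition varZ : {mpoly k[m + 2]} := 'X_(rshift m ord0).
Definition varT : {mpoly k[m + 2]} := 'X_(rshift m ord_max).

Definition ZTpoly (f : {mpoly k[2]}) : {mpoly k[m + 2]} :=
  f \mPo [tuple varZ; varT].

Definition in_idealX (h : {mpoly k[m + 2]}) : Prop :=
  exists g : 'I_m -> {mpoly k[m + 2]}, h = \sum_i g i * varX i.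

Definition Xpow (r : 'I_m -> nat) : {mpoly k[m + 2]} :=
  \prod_i varX i ^+ r i.

Definition relator (r : 'I_m -> nat) (F : {mpoly k[m + 2]}) :
    {mpoly k[(m + 2).+1]} :=
  mwiden (Xpow r) * 'X_ord_max - mwiden F.

End Presentation.

(* pi identifies A with the quotient of P by the principal ideal (G). *)
Definition is_quotient (k : fieldType) (P A : comAlgType k) (G : P)
    (pi : {lrmorphism P -> A}) : Prop :=
  (forall a, exists p, pi p = a) /\
  (forall p, pi p = 0 <-> exists q, p = q * G).

Section Images.
Variables (k : fieldType) (m : nat) (A : comAlgType k).
Variable pi : {lrmorphism {mpoly k[(m + 2).+1]} -> A}.

Definition im (p : {mpoly k[m + 2]}) : A := pi (mwiden p).

Definition subE : set A := gen_subalg (range (fun i => im (varX k i))).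

Definition subB : set A :=
  gen_subalg (range (fun i => im (varX k i)) `|`
              [set im (varZ k m); im (varT k m)]).

Definition idI (r : 'I_m -> nat) (F : {mpoly k[m + 2]}) : set A :=
  gen_ideal2 subB (\prod_i im (varX k i) ^+ r i) (im F).

Definition condA (phi : {lrmorphism A -> A}) : Prop :=
  restricts_to_aut phi subE /\ restricts_to_aut phi subB.

Definition condB (r : 'I_m -> nat) (phi : {lrmorphism A -> A}) : Prop :=
  forall i, exists j, exists lambda : k,
    [/\ lambda != 0, phi (im (varX k i)) = lambda *: im (varX k j)
      & r i = r j].

Definition condC (r : 'I_m -> nat) (F : {mpoly k[m + 2]})
    (phi : {lrmorphism A -> A}) : Prop :=
  phi @` idI r F = idI r F.

End Images.

(* Main.v *)
Require Import Defs.
From HB Require Import structures.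
From mathcomp Require Import all_boot all_order all_algebra.
From mathcomp Require Import boolp classical_sets functions.
From mathcomp Require Import mpoly.
From mathcomp Require Import ring.

Set Implicit Arguments.
Unset Strict Implicit.
Unset Printing Implicit Defensive.

Import GRing.Theory.

Local Open Scope classical_set_scope.
Local Open Scope ring_scope.

(* A = B[y] with x^r y = F embeds in B[1/(x_1 ... x_m)], and the
   intersection of cA with B lies in (c, F)B for every c in B; for c = x^r it is I.

   An automorphism phi preserves DK(A) = B.  Clearing denominators in phi(y), the
   prime phi(x_i) of B divides a power of x_1 ... x_m, so phi(x_i) = lambda x_j.
   If r_i > r_j, then x_j^(r_j + 1) divides phi(F) in A, which puts w phi(F) in
   (x_j, F^2)B for w the product of the x_l^(r_l), l <> j, whereas F lies in
   (x_j, phi(F))B.  Hence F mod x_j divides w, and so is a constant.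

   That, and more generally F mod x_j lying in k[x_1, ..., x_m], is impossible:
   F mod x_j divided by x_j would be an element of A outside B invariant under the
   exponential map z |-> z + x^r U.  The same fact shows that I meets E in x^r E,
   so in the converse phi(x^r) = lambda x^r; since F is in phi(I), y is in phi(A),
   and (b) then follows from the direct part. *)

(** * Divisibility and prime elements in an integral domain *)

Section Divisibility.
Variable R : idomainType.
Implicit Types a b c d p q : R.

Definition divides a b := exists c, b = c * a.

Definition prime_elt p :=
  [/\ p != 0, ~ divides p 1
    & forall a b, divides p (a * b) -> divides p a \/ divides p b].

Lemma divides_mull c a b : divides a b -> divides a (c * b).
Proof. by case=> d ->; exists (c * d); rewrite mulrA. Qed.

Lemma divides_mulr c a b : divides a b -> divides a (b * c).
Proof. by rewrite mulrC; apply: divides_mull. Qed.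

Lemma prime_dvd_exp p a n : prime_elt p -> divides p (a ^+ n) -> divides p a.
Proof.
case=> _ p1 pM; elim: n => [/p1 //|n IHn].
by rewrite exprS => /pM[].
Qed.

Lemma prime_dvd_prod p (I : finType) (G : I -> R) (e : I -> nat) :
  prime_elt p -> divides p (\prod_i G i ^+ e i) -> exists i, divides p (G i).
Proof.
move=> pp; have [_ p1 pM] := pp.
apply: (big_ind (fun x => divides p x -> exists i, divides p (G i))).
- by move/p1.
- by move=> x y IHx IHy /pM[/IHx|/IHy].
- by move=> i _ /(prime_dvd_exp pp); exists i.
Qed.

Lemma prime_dvd_prime p q : prime_elt p -> prime_elt q -> divides p q ->
  exists2 c, divides c 1 & p = c * q.
Proof.
case=> p0 p1 _ [q0 q1 qM] [c qE].
have [] : divides q c \/ divides q p by apply: qM; exists 1; rewrite mul1r.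
- case=> d cE; case: p1; exists d; apply: (mulfI q0).
  by rewrite mulr1 {1}qE cE; ring.
- case=> d pE; exists d => //; exists c; apply: (mulIf p0).
  by rewrite mul1r -mulrA [RHS]mulrCA -qE -pE.
Qed.

(** The primes are removed one at a time: [G i] divides the product of [d] and its cofactor but not
    [d], so it divides the cofactor and cancels. *)
Lemma prod_primes_cancel (I : finType) (P : pred I) (G : I -> R) (e : I -> nat)
    d b :
  (forall i, P i -> prime_elt (G i) /\ ~ divides (G i) d) ->
  divides d ((\prod_(i | P i) G i ^+ e i) * b) -> divides d b.
Proof.
move=> Gd; move: b.
apply: (big_ind (fun x => forall b, divides d (x * b) -> divides d b)).
- by move=> b; rewrite mul1r.
- by move=> x y IHx IHy b; rewrite -mulrA => /IHx/IHy.
- move=> i /Gd[[G0 _ GM] Gid]; elim: (e i) => [|n IHn] b.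
    by rewrite expr0 mul1r.
  rewrite exprS -mulrA => -[c cE].
  have [] : divides (G i) c \/ divides (G i) d.
    by apply: GM; rewrite -cE; exists (G i ^+ n * b); rewrite mulrC.
  - case=> c' c'E; apply: IHn; exists c'; apply: (mulfI G0).
    by rewrite cE c'E; ring.
  - by [].
Qed.

End Divisibility.

Lemma prime_elt_bij (R : idomainType) (f : {rmorphism R -> R}) p :
  bijective f -> prime_elt p -> prime_elt (f p).
Proof.
case=> g fK gK [p0 p1 pM].
have dvdf a : divides (f p) a -> divides p (g a).
  by case=> c ->; exists (g c); apply: (can_inj fK); rewrite rmorphM !gK.
split.
- by apply: contra_neq p0 => fp0; apply: (can_inj fK); rewrite fp0 rmorph0.
- by move=> /dvdf; rewrite -(rmorph1 f) fK.
- move=> a b /dvdf.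
  have -> : g (a * b) = g a * g b.
    by apply: (can_inj fK); rewrite rmorphM !gK.
  by case/pM=> -[c cE]; [left|right]; exists (f c); rewrite -rmorphM -cE gK.
Qed.

Lemma rmorphism_of (R S : pzRingType) (f : R -> S) :
  {morph f : x y / x - y} -> f 1 = 1 -> {morph f : x y / x * y} ->
  {g : {rmorphism R -> S} | g =1 f}.
Proof.
move=> fB f1 fM.
pose g : {rmorphism R -> S} := HB.pack f
  (GRing.isZmodMorphism.Build R S f fB)
  (GRing.isMonoidMorphism.Build R S f (f1, fM)).
by exists g.
Qed.

(** * Multivariate polynomials and reduction modulo a variable *)

Section Mpoly.
Variables (k : fieldType) (n : nat).
Implicit Types p q : {mpoly k[n]}.

Lemma mpoly_ring_ind (K : {mpoly k[n]} -> Prop) :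
  (forall c, K c%:MP) -> (forall i, K 'X_i) ->
  (forall p q, K p -> K q -> K (p + q)) ->
  (forall p q, K p -> K q -> K (p * q)) -> forall p, K p.
Proof.
move=> KC KX KD KM p; rewrite (mpolyE p).
apply: big_ind => [||m _]; [by rewrite -mpolyC0|exact: KD|].
rewrite -mul_mpolyC mpolyXE_id; apply: (KM) => //.
apply: big_ind => [||i _]; [by rewrite -mpolyC1|exact: KM|].
elim: (m i) => [|j IHj]; first by rewrite expr0 -mpolyC1.
by rewrite exprS; apply: KM.
Qed.

Lemma mpoly_rmorph_ext (S : nzRingType) (f g : {rmorphism {mpoly k[n]} -> S}) :
  (forall c, f c%:MP = g c%:MP) -> (forall i, f 'X_i = g 'X_i) -> f =1 g.
Proof.
move=> fgC fgX; elim/mpoly_ring_ind => //.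
- by move=> p q fp fq; rewrite !rmorphD fp fq.
- by move=> p q fp fq; rewrite !rmorphM fp fq.
Qed.

(** Reduction modulo ['X_i], with the quotient realized as a subring of the same polynomial ring. *)
Definition kill (i : 'I_n) p : {mpoly k[n]} :=
  p \mPo [tuple if j == i then 0 else 'X_j | j < n].
HB.instance Definition _ i := GRing.RMorphism.copy (kill i) (kill i).

Lemma killX i j : kill i 'X_j = if j == i then 0 else 'X_j.
Proof. by rewrite /kill comp_mpolyXU -tnth_nth tnth_mktuple. Qed.

Lemma killC i c : kill i c%:MP = c%:MP.
Proof. exact: comp_mpolyC. Qed.

Lemma kill_modX i p : exists q, p = kill i p + q * 'X_i.
Proof.
elim/mpoly_ring_ind: p => [c|j|p q [u uE] [v vE]|p q [u uE] [v vE]].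
- by exists 0; rewrite killC mul0r addr0.
- rewrite killX; case: eqP => [->|_]; last by exists 0; rewrite mul0r addr0.
  by exists 1; rewrite mul1r add0r.
- by exists (u + v); rewrite rmorphD {1}uE {1}vE; ring.
- exists (u * kill i q + kill i p * v + u * v * 'X_i).
  by rewrite rmorphM {1}uE {1}vE; ring.
Qed.

Lemma dividesX i p : divides 'X_i p <-> kill i p = 0.
Proof.
split=> [[c ->]|ip0]; first by rewrite rmorphM /= killX eqxx mulr0.
by have [q] := kill_modX i p; rewrite ip0 add0r; exists q.
Qed.

Lemma mpolyX_neq0 i : 'X_i != 0 :> {mpoly k[n]}.
Proof.
apply/eqP => /(congr1 (mcoeff U_(i))); rewrite mcoeffXU mcoeff0 eqxx.
exact/eqP/oner_neq0.
Qed.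

Lemma primeX i : prime_elt ('X_i : {mpoly k[n]}).
Proof.
split; first exact: mpolyX_neq0.
- by rewrite dividesX rmorph1; apply/eqP/oner_neq0.
- move=> a b; rewrite !dividesX rmorphM => /eqP.
  by rewrite mulf_eq0 => /orP[]/eqP; [left|right].
Qed.

Lemma dividesXX i j : divides ('X_i : {mpoly k[n]}) 'X_j -> i = j.
Proof.
rewrite dividesX killX; case: eqP => [->//|_ /eqP].
by rewrite (negPf (mpolyX_neq0 j)).
Qed.

Lemma divides1_mpoly p : divides p 1 -> exists2 c, c != 0 & p = c%:MP.
Proof.
case=> q /esym/mpoly_intro_unit/andP[/eqP pE].
by rewrite unitfE; exists p@_0.
Qed.

End Mpoly.

Lemma size_factor_le1 (R : idomainType) (p q : {poly R}) :
  p != 0 -> q != 0 -> (size (p * q)%R <= 1)%N -> (size q <= 1)%N.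
Proof.
move=> p0 q0; rewrite size_mul //.
move: p0; rewrite -size_poly_gt0; case: (size p) => // a _.
by apply: leq_trans; rewrite leq_addl.
Qed.

(** * Substitutions in k[X, Z, T], and its subring k[X] *)

Section PolynomialRing.
Variables (k : fieldType) (m : nat).
Local Notation P := {mpoly k[m + 2]}.
Implicit Types p q : P.

Definition kill_varX (j : 'I_m) : P -> P := kill (lshift 2 j).
HB.instance Definition _ j := GRing.RMorphism.copy (kill_varX j) (kill_varX j).

(** A retraction onto k[X]; the equation [killZT p = p] expresses that [p] lies in k[X]. *)
Definition killZT p : P :=
  p \mPo [tuple if fintype.split i is inl _ then 'X_i else 0 | i < m + 2].
HB.instance Definition _ := GRing.RMorphism.copy killZT killZT.

Definition killXs p : {mpoly k[2]} :=
  p \mPo [tuple if fintype.split i is inr j then 'X_j else 0 | i < m + 2].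
HB.instance Definition _ := GRing.RMorphism.copy killXs killXs.

Lemma killX_varX j i : kill_varX j (varX k i) = if i == j then 0 else varX k i.
Proof. by rewrite /kill_varX killX (inj_eq (@lshift_inj _ _)). Qed.

Lemma killZT_varX i : killZT (varX k i) = varX k i.
Proof.
rewrite /killZT comp_mpolyXU -tnth_nth tnth_mktuple.
by rewrite (unsplitK (inl i)).
Qed.

Lemma killZT_rshift i : killZT 'X_(rshift m i) = 0.
Proof.
rewrite /killZT comp_mpolyXU -tnth_nth tnth_mktuple.
by rewrite (unsplitK (inr i)).
Qed.

Lemma killXs_varX i : killXs (varX k i) = 0.
Proof.
rewrite /killXs comp_mpolyXU -tnth_nth tnth_mktuple.
by rewrite (unsplitK (inl i)).
Qed.

Lemma killXs_rshift i : killXs 'X_(rshift m i) = 'X_i.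
Proof.
rewrite /killXs comp_mpolyXU -tnth_nth tnth_mktuple.
by rewrite (unsplitK (inr i)).
Qed.

Lemma ord_split_ind (K : 'I_(m + 2) -> Prop) : (forall i, K (lshift 2 i)) ->
  (forall i, K (rshift m i)) -> forall i, K i.
Proof. by move=> KX KZT i; case: (split_ordP i) => j ->. Qed.

Lemma killXs_killX j p : killXs (kill_varX j p) = killXs p.
Proof.
move: p; apply: (mpoly_rmorph_ext (f := killXs \o kill_varX j)).
  by move=> c /=; rewrite /kill_varX killC.
apply: ord_split_ind => i /=; rewrite -?/(varX k i);
  first by rewrite killX_varX; case: eqP => // ->;
  rewrite rmorph0 killXs_varX.
by rewrite /kill_varX killX eq_rlshift.
Qed.

Lemma killZT_killX j p : killZT (kill_varX j p) = kill_varX j (killZT p).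
Proof.
move: p; apply: (mpoly_rmorph_ext (f := killZT \o kill_varX j)
                                  (g := kill_varX j \o killZT)).
  by move=> c /=; rewrite /kill_varX /killZT killC comp_mpolyC killC.
apply: ord_split_ind => i /=; rewrite -?/(varX k i).
  by rewrite killX_varX killZT_varX killX_varX; case: eqP => // _;
    rewrite ?rmorph0 ?killZT_varX.
by rewrite /kill_varX killX eq_rlshift killZT_rshift rmorph0.
Qed.

(** This turns [f != 0] into [killXs F != 0], the form in which later arguments use it: no X_j
    divides F, and F mod X_j is nonzero. *)
Lemma killXs_F f h F : in_idealX h -> F = ZTpoly m f + h -> killXs F = f.
Proof.
move=> [g hE] ->; rewrite rmorphD /=.
have -> : killXs h = 0.
  rewrite hE raddf_sum big1 // => i _.
  by rewrite [LHS](rmorphM killXs) /= killXs_varX mulr0.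
rewrite addr0; move: f.
apply: (mpoly_rmorph_ext (f := killXs \o @ZTpoly k m) (g := idfun)).
  by move=> c /=; rewrite /ZTpoly /killXs !comp_mpolyC.
move=> i /=; rewrite /ZTpoly comp_mpolyXU.
case: i => -[|[|//]] ilt; rewrite /= killXs_rshift; congr 'X_ _;
  exact: val_inj.
Qed.

Lemma varX_ndivides j p : killXs p != 0 -> ~ divides (varX k j) p.
Proof. by move=> + [c pE]; rewrite pE rmorphM /= killXs_varX mulr0 eqxx. Qed.

Lemma killX_neq0 j p : killXs p != 0 -> kill_varX j p != 0.
Proof.
by move=> p0; apply: contra_neq p0 => jp0; rewrite -(killXs_killX j) jp0 rmorph0.
Qed.

(* The degree in 'X is the weight for which Z and T have weight one. *)
Definition scaleZT p : {poly P} :=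
  mmap (polyC \o @mpolyC (m + 2) k)
    (fun i => if fintype.split i is inl _ then ('X_i)%:P else 'X_i *: 'X) p.
HB.instance Definition _ := GRing.RMorphism.copy scaleZT scaleZT.

Lemma scaleZTC c : scaleZT c%:MP = c%:MP%:P.
Proof. by rewrite /scaleZT mmapC. Qed.

Lemma scaleZT_varX i : scaleZT (varX k i) = (varX k i)%:P.
Proof. by rewrite /scaleZT mmapX mmap1U (unsplitK (inl i)). Qed.

Lemma scaleZT_rshift i :
  scaleZT 'X_(rshift m i) = 'X_(rshift m i) *: 'X.
Proof. by rewrite /scaleZT mmapX mmap1U (unsplitK (inr i)). Qed.

Lemma scaleZT1 p : (scaleZT p).[1] = p.
Proof.
move: p; apply: (mpoly_rmorph_ext (f := horner_eval 1 \o scaleZT) (g := idfun)).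
  by move=> c /=; rewrite scaleZTC /horner_eval hornerC.
by apply: ord_split_ind => i /=; rewrite -?/(varX k i) ?scaleZT_varX ?scaleZT_rshift
  /horner_eval !hornerE.
Qed.

Lemma scaleZT0 p : (scaleZT p).[0] = killZT p.
Proof.
move: p; apply: (mpoly_rmorph_ext (f := horner_eval 0 \o scaleZT) (g := killZT)).
  by move=> c /=; rewrite scaleZTC /horner_eval hornerC /killZT comp_mpolyC.
by apply: ord_split_ind => i /=; rewrite -?/(varX k i) ?scaleZT_varX ?scaleZT_rshift
  /horner_eval !hornerE ?killZT_varX ?killZT_rshift.
Qed.

Lemma scaleZT_killZT p : scaleZT (killZT p) = (killZT p)%:P.
Proof.
move: p; apply: (mpoly_rmorph_ext (f := scaleZT \o killZT)
                                  (g := polyC \o killZT)).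
  by move=> c /=; rewrite /killZT comp_mpolyC scaleZTC.
by apply: ord_split_ind => i /=; rewrite -?/(varX k i) ?killZT_varX ?killZT_rshift
  ?scaleZT_varX ?rmorph0.
Qed.

Lemma killZT_id p : killZT p = p <-> (size (scaleZT p) <= 1)%N.
Proof.
split=> [<-|/size1_polyC sp]; first by rewrite scaleZT_killZT size_polyC leq_b1.
by rewrite -scaleZT0 -[RHS]scaleZT1 sp !hornerC.
Qed.

(** k[X] is factorially closed in k[X, Z, T]: it consists of the elements of weighted degree at most
    zero, and the degree of a nonzero product is the sum of the degrees. *)
Lemma killZT_factor p q : p * q != 0 -> killZT (p * q) = p * q -> killZT q = q.
Proof.
move=> pq0 /killZT_id; rewrite killZT_id rmorphM /=.
have tau0 x : x != 0 -> scaleZT x != 0.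
  by move=> x0; apply: contra_neq x0 => sx; rewrite -(scaleZT1 x) sx horner0.
move: pq0; rewrite mulf_eq0 negb_or => /andP[/tau0 p0 /tau0 q0].
by move=> spq; apply: (size_factor_le1 p0 q0); exact: spq.
Qed.

End PolynomialRing.

(** * Polynomials in n + 1 variables as univariate polynomials in the last one *)

Section LastVariable.
Variables (k : fieldType) (n : nat).

Lemma muniX_max : muni ('X_ord_max : {mpoly k[n.+1]}) = 'X.
Proof.
rewrite /muni mmapX mmap1U; case: fintype.splitP => //= j.
by move=> jE; have := ltn_ord j; rewrite -jE ltnn.
Qed.

Lemma muniX_widen (i : 'I_n) :
  muni ('X_(widen_ord (leqnSn n) i) : {mpoly k[n.+1]}) = ('X_i)%:P.
Proof.
rewrite /muni mmapX mmap1U; case: fintype.splitP => [j /= ij|j /= ij].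
  by congr ('X_ _)%:P; apply/val_inj.
by have := ltn_ord i; rewrite ij ltnNge leq_addr.
Qed.

Lemma mwidenXU (i : 'I_n) :
  mwiden ('X_i : {mpoly k[n]}) = 'X_(widen_ord (leqnSn n) i).
Proof. by rewrite /mwiden mmapX mmap1U. Qed.

Lemma muni_mwiden (p : {mpoly k[n]}) : muni (mwiden p) = p%:P.
Proof.
move: p; apply: (mpoly_rmorph_ext (f := @muni n k \o @mwiden n k) (g := polyC)).
  by move=> c /=; rewrite mwidenC muniC.
by move=> i /=; rewrite mwidenXU muniX_widen.
Qed.

(** Together with [horner_muni], this makes [muni] an isomorphism whose inverse evaluates at the
    last variable. *)
Lemma muni_horner (q : {poly {mpoly k[n]}}) :
  muni (map_poly (@mwiden n k) q).['X_ord_max] = q.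
Proof.
rewrite -horner_map /= muniX_max -map_poly_comp /=.
rewrite (eq_map_poly (g := polyC)) => [|p]; last exact: muni_mwiden.
exact: comp_polyXr.
Qed.

Lemma horner_muni (p : {mpoly k[n.+1]}) :
  (map_poly (@mwiden n k) (muni p)).['X_ord_max] = p.
Proof.
move: p; apply: (mpoly_rmorph_ext (g := idfun)
  (f := horner_eval 'X_ord_max \o map_poly (@mwiden n k) \o @muni n k)).
  by move=> c /=; rewrite muniC map_polyC /horner_eval hornerC /= mwidenC.
move=> i /=; case: (unliftP ord_max i) => [j ->|->].
  have -> : lift ord_max j = widen_ord (leqnSn n) j by apply/val_inj/lift_max.
  by rewrite muniX_widen map_polyC /horner_eval hornerC /= mwidenXU.
by rewrite muniX_max map_polyX /horner_eval hornerX.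
Qed.

End LastVariable.

(** * The map from k[X, Z, T] to A *)

Section Images.
Variables (k : fieldType) (m : nat) (A : comAlgType k).
Variable pi : {lrmorphism {mpoly k[(m + 2).+1]} -> A}.
Local Notation P := {mpoly k[m + 2]}.
Local Notation im := (im pi).
Local Notation y := (pi 'X_ord_max).

HB.instance Definition _ :=
  GRing.RMorphism.copy im (pi \o @mwiden (m + 2) k).

Lemma imC c : im c%:MP = c%:A.
Proof. by rewrite /im mwidenC -alg_mpolyC linearZ /= rmorph1. Qed.

Lemma pi_horner (q : {poly P}) :
  pi (map_poly (@mwiden (m + 2) k) q).['X_ord_max] = (map_poly im q).[y].
Proof. by rewrite -horner_map /= -map_poly_comp. Qed.

End Images.

Lemma prime_exp_cancel (R : idomainType) (p f v : R) s :
  prime_elt p -> ~ divides p f ->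
  divides (p ^+ s) (f * v) -> divides (p ^+ s) v.
Proof.
move=> [p0 _ pM] pf; elim: s v => [|s IHs] v; first by exists v; rewrite mulr1.
case=> c cE; case: (pM f v) => [|//|[d dE]].
  by exists (c * p ^+ s); rewrite cE exprS; ring.
have [|e eE] := IHs d.
  exists c; apply: (mulIf p0).
  by rewrite -mulrA -dE cE exprS; ring.
by exists e; rewrite dE eE exprS; ring.
Qed.

Lemma polyC_divides (R : idomainType) (c : R) (q : {poly R}) :
  (forall n, divides c q`_n) -> exists q', q = q' * c%:P.
Proof.
move=> /choice[g gE]; exists (\poly_(i < size q) g i).
apply/polyP => i; rewrite coefMC coef_poly.
by case: ltnP => [_|/(nth_default 0) ->]; rewrite ?mul0r ?gE.
Qed.


(** * The algebra A = R[Y] / (M Y - F) over a domain R *)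

Section AffineModification.
Variables (R : idomainType) (A : comNzRingType) (im : {rmorphism R -> A}).
Variables (y : A) (M F : R).
Local Notation rel := (M%:P * 'X - F%:P).
Local Notation ev q := (map_poly im q).[y].
Hypothesis M0 : M != 0.
Hypothesis ev_onto : forall a, exists q, ev q = a.
Hypothesis ev_eq0 : forall q, ev q = 0 <-> exists q', q = q' * rel.

Lemma coef0_rel q : (q * rel)`_0 = - (q`_0 * F).
Proof. by rewrite mulrBr mulrA coefB coefMX !coefMC /= sub0r. Qed.

Lemma coefS_rel q n : (q * rel)`_n.+1 = q`_n * M - q`_n.+1 * F.
Proof. by rewrite mulrBr mulrA coefB coefMX !coefMC. Qed.

Lemma evC p : ev p%:P = im p.
Proof. by rewrite map_polyC hornerC. Qed.

Lemma evM p q : ev (p * q) = ev p * ev q.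
Proof. by rewrite rmorphM hornerM. Qed.

Lemma evB p q : ev (p - q) = ev p - ev q.
Proof. by rewrite rmorphB hornerD hornerN. Qed.

Lemma im_rel : im M * y = im F.
Proof.
have /ev_eq0 : exists q', rel = q' * rel by exists 1; rewrite mul1r.
by rewrite evB evM !evC map_polyX hornerX => /eqP; rewrite subr_eq0 => /eqP.
Qed.

(** As [M] is nonzero, [rel] has degree one in Y, so none of its nonzero multiples is constant. *)
Lemma im_eq0 p : im p = 0 -> p = 0.
Proof.
rewrite -evC => /ev_eq0[q' pE].
have [->|p0] := eqVneq p 0; first by [].
have : q' * rel != 0 by rewrite -pE polyC_eq0.
rewrite mulf_eq0 negb_or => /andP[q0 R0].
have /(nth_default 0) : (size rel <= 1)%N.
  by apply: (size_factor_le1 q0 R0); rewrite -pE size_polyC leq_b1.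
by rewrite coefB coefMX !coefC /= subr0 => /eqP; rewrite (negPf M0).
Qed.

Lemma im_inj : injective im.
Proof.
move=> p q pq; apply/eqP; rewrite -subr_eq0; apply/eqP/im_eq0.
by rewrite rmorphB pq subrr.
Qed.

(** Lift [a] to a polynomial in Y and compare constant coefficients; at Y = 0 the relation becomes
    -F. *)
Lemma im_divides b c a : im b = im c * a -> exists u v, b = u * c + v * F.
Proof.
have [q <-] := ev_onto a => bE.
have /ev_eq0[q' /(congr1 (coefp 0))] : ev (b%:P - c%:P * q) = 0.
  by rewrite evB evM !evC bE subrr.
rewrite /= coef0_rel coefB coefC coefCM /= => bqE.
by exists q`_0, (- q'`_0); rewrite mulNr -bqE; ring.
Qed.

(** Modulo [p] the relation is -F. If [p] times a lift of [a] equals [q' * rel], then [p] divides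
    every coefficient of [q'] and cancels. *)
Lemma im_prime_regular p a : prime_elt p -> ~ divides p F -> divides p M ->
  im p * a = 0 -> a = 0.
Proof.
move=> pp pF [w ME]; have [p0 _ pM] := pp.
have [q <-] := ev_onto a => aE.
have /ev_eq0[q' qE] : ev (q * p%:P) = 0 by rewrite evM evC mulrC.
have pq' n : divides p (q'`_n * F).
  case: n => [|n].
    exists (- q`_0); move: qE => /(congr1 (coefp 0)).
    by rewrite /= coef0_rel coefMC mulNr => ->; rewrite opprK.
  exists (q'`_n * w - q`_n.+1); move: qE => /(congr1 (coefp n.+1)).
  rewrite /= coefS_rel coefMC mulrBl => ->; rewrite ME; ring.
have [|q'' q'E] := @polyC_divides _ p q'.
  by move=> n; case: (pM _ _ (pq' n)).
apply/ev_eq0; exists q''.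
have pC0 : p%:P != 0 by rewrite polyC_eq0.
by apply: (mulIf pC0); rewrite qE q'E mulrAC.
Qed.

(** Induction on the degree in [y], each occurrence of [y] being absorbed by [im M * y = im F]. *)
Lemma clear_denominators a : exists n b, im M ^+ n * a = im b.
Proof.
have [q <-] := ev_onto a; elim/poly_ind: q => [|q c [n [b bE]]].
  by exists 0, 0; rewrite !rmorph0 horner0 mulr0.
exists n.+1, (b * F + M ^+ n.+1 * c).
rewrite rmorphD rmorphM hornerD hornerM /= map_polyX hornerX evC.
rewrite [RHS]rmorphD !rmorphM rmorphXn -bE -im_rel exprS; ring.
Qed.

(** A power of [im M] brings any element of [A] into the image of [R], and [f (im M)] can be
    cancelled in [S]. *)
Lemma rmorph_ext_im (S : comNzRingType) (f g : {rmorphism A -> S}) :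
  (forall c, f (im M) * c = 0 -> c = 0) ->
  (forall p, f (im p) = g (im p)) -> f =1 g.
Proof.
move=> freg fg a; have [n [b bE]] := clear_denominators a.
have fregn c : f (im M) ^+ n * c = 0 -> c = 0.
  elim: n {bE} => [|n IHn]; first by rewrite expr0 mul1r.
  by rewrite exprS -mulrA => /freg/IHn.
apply/eqP; rewrite -subr_eq0; apply/eqP/fregn.
have fE : f (im M) ^+ n * f a = f (im b) by rewrite -rmorphXn -rmorphM bE.
have gE : f (im M) ^+ n * g a = f (im b) by rewrite !fg -rmorphXn -rmorphM bE.
by rewrite mulrBr fE gE subrr.
Qed.

(* The constant coefficient of the relation gives b = - q'_0 F mod p, and the
   coefficient of Y puts w q'_0 in (p, F). *)
Lemma im_divides_square p w s b a : M = w * p ^+ s ->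
  prime_elt p -> ~ divides p F -> im b = im (p ^+ s.+1) * a ->
  exists u v, w * b = u * p + v * F ^+ 2.
Proof.
move=> ME pp pF; have [p0 _ _] := pp; have [q <-] := ev_onto a => bE.
have /ev_eq0[q' qE] : ev (b%:P - (p ^+ s.+1)%:P * q) = 0.
  by rewrite evB evM !evC bE subrr.
have qE0 : b - p ^+ s.+1 * q`_0 = - (q'`_0 * F).
  by move: qE => /(congr1 (coefp 0)); rewrite /= coef0_rel coefB coefC coefCM.
have qE1 : - (p ^+ s.+1 * q`_1) = q'`_0 * M - q'`_1 * F.
  move: qE => /(congr1 (coefp 1)).
  by rewrite /= coefS_rel coefB coefC coefCM sub0r.
(* By [qE1] and [M = w * p ^+ s], the power [p ^+ s] divides [F] times the coefficient of Y in [q'],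
   hence divides that coefficient; all of [qE1] can then be divided by [p ^+ s]. *)
have [|p1 p1E] := @prime_exp_cancel _ p F q'`_1 s pp pF.
  exists (q'`_0 * w + p * q`_1).
  have -> : F * q'`_1 = q'`_0 * M - (q'`_0 * M - q'`_1 * F) by ring.
  rewrite -qE1 ME exprS; ring.
have wE : w * q'`_0 = p1 * F - p * q`_1.
  have ps0 : p ^+ s != 0 by rewrite expf_neq0.
  apply: (mulIf ps0); rewrite mulrBl.
  have -> : p * q`_1 * p ^+ s = - - (p ^+ s.+1 * q`_1).
    by rewrite opprK exprS; ring.
  rewrite qE1 p1E ME; ring.
exists (w * p ^+ s * q`_0 + q`_1 * F), (- p1).
have -> : b = p ^+ s.+1 * q`_0 - q'`_0 * F by rewrite -qE0; ring.
rewrite mulrBr [w * (q'`_0 * F)]mulrA wE exprS; ring.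
Qed.

End AffineModification.

(** * The universal property of the quotient *)

Section Factorization.
Variables (R A S : comNzRingType) (im : {rmorphism R -> A}) (y : A) (rel : {poly R}).
Hypothesis ev_onto : forall a, exists q, (map_poly im q).[y] = a.
Hypothesis ev_eq0 :
  forall q, (map_poly im q).[y] = 0 <-> exists q', q = q' * rel.

Lemma rmorph_factor (psi : {rmorphism R -> S}) (s : S) :
  (map_poly psi rel).[s] = 0 ->
  exists phi : {rmorphism A -> S}, forall p, phi (im p) = psi p.
Proof.
move=> rel0; have [g gE] := choice ev_onto.
pose ev q := (map_poly im q).[y]; pose ev' q := (map_poly psi q).[s].
have ev'E q a : ev q = a -> ev' (g a) = ev' q.
  move=> qa; have /ev_eq0[q' qE] : (map_poly im (g a - q)).[y] = 0.
    by rewrite rmorphB hornerD hornerN gE -qa subrr.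
  apply/eqP; rewrite -subr_eq0 /ev' -hornerN -hornerD -rmorphB qE.
  by rewrite rmorphM hornerM rel0 mulr0.
have [||| phi phiE] := @rmorphism_of A S (ev' \o g).
- move=> a b /=; rewrite (ev'E (g a - g b)).
    by rewrite /ev' rmorphB hornerD hornerN.
  by rewrite /ev rmorphB hornerD hornerN /= !gE.
- rewrite /= (ev'E 1); first by rewrite /ev' rmorph1 hornerC.
  by rewrite /ev rmorph1 hornerC.
- move=> a b /=; rewrite (ev'E (g a * g b)).
    by rewrite /ev' rmorphM hornerM.
  by rewrite /ev rmorphM hornerM /= !gE.
exists phi => p; rewrite phiE /= (ev'E p%:P).
  by rewrite /ev' map_polyC hornerC.
by rewrite /ev map_polyC hornerC.
Qed.

End Factorization.

Lemma polyC_regular (R : comNzRingType) (c : R) :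
  (forall a, c * a = 0 -> a = 0) -> forall q, c%:P * q = 0 -> q = 0.
Proof.
move=> creg q cq0; apply/polyP => i; rewrite coef0; apply: creg.
by rewrite -coefCM cq0 coef0.
Qed.

(** * Generated subalgebras and the invariance of the Derksen invariant *)

Section Subalgebras.
Variables (k : fieldType) (A : comAlgType k).
Implicit Types (S G : set A).

Lemma subalg_closedE S : GRing.subalg_closed (mem S) <->
  [/\ S 1, forall c u v, S u -> S v -> S (c *: u + v)
    & forall u v, S u -> S v -> S (u * v)].
Proof.
split=> -[S1 SD SM]; split; rewrite ?inE //.
- by move: S1; rewrite inE.
- by move=> c u v Su Sv; have := SD c u v; rewrite !inE; apply.
- by move=> u v Su Sv; have := SM u v; rewrite !inE; apply.
- by move=> c u v; rewrite !inE; apply: SD.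
- by move=> u v; rewrite !inE; apply: SM.
Qed.

Lemma gen_subalg_closed G : GRing.subalg_closed (mem (gen_subalg G)).
Proof.
apply/subalg_closedE; split=> [S [/subalg_closedE[]]//|c u v uG vG|u v uG vG] S SG;
have [/subalg_closedE[_ SD SM] _] := SG.
- by apply: SD; [apply: uG|apply: vG].
- by apply: SM; [apply: uG|apply: vG].
Qed.

Lemma gen_subalg_map (phi : {lrmorphism A -> A}) G G' :
  (forall a, G a -> gen_subalg G' (phi a)) ->
  forall a, gen_subalg G a -> gen_subalg G' (phi a).
Proof.
move=> phiG; apply: (smallest_sub (X := [set a | gen_subalg G' (phi a)])) => //.
have /subalg_closedE[G1 GD GM] := gen_subalg_closed G'.
apply/subalg_closedE; split=> [|c u v|u v] /=.
- by rewrite rmorph1.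
- by rewrite linearP; apply: GD.
- by rewrite rmorphM; apply: GM.
Qed.

Lemma gen_subalg_rmorph n (f : {rmorphism {mpoly k[n]} -> A}) G :
  (forall c, f c%:MP = c%:A) -> (forall i, gen_subalg G (f 'X_i)) ->
  forall p, gen_subalg G (f p).
Proof.
have /subalg_closedE[G1 GD GM] := gen_subalg_closed G.
have G0 : gen_subalg G 0 by rewrite -(subrr 1) addrC -scaleN1r; apply: GD.
move=> fC fX; elim/mpoly_ring_ind => //.
- by move=> c; rewrite fC -[c%:A]addr0; apply: GD.
- by move=> p q pG qG; rewrite rmorphD -[f p]scale1r; apply: GD.
- by move=> p q pG qG; rewrite rmorphM; apply: GM.
Qed.

Lemma lrmorph_alg (phi : {lrmorphism A -> A}) (c : k) : phi c%:A = c%:A.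
Proof. by rewrite linearZ /= rmorph1. Qed.

(** Conjugating an exponential map by [phi] gives an exponential map whose invariants are the images
    under [phi] of the original ones. *)
Lemma Derksen_automorphism (phi psi : {lrmorphism A -> A}) :
  cancel phi psi -> cancel psi phi ->
  forall a, Derksen a -> Derksen (phi a).
Proof.
move=> phiK psiK; apply: gen_subalg_map => a [e [[eC e0 eD] e_proper ea]].
apply: sub_gen_smallest.
pose e' : {rmorphism A -> {poly A}} := map_poly phi \o e \o psi.
have e'E b : e' b = b%:P <-> e (psi b) = (psi b)%:P.
  split=> [|eb]; last by rewrite /e' /= eb map_polyC /= psiK.
  move=> /(congr1 (map_poly psi)); rewrite /e' /= map_polyC /= => <-.
  by rewrite -map_poly_comp map_poly_id // => x _; rewrite /= phiK.
exists e'; split; last by rewrite /exp_inv /= e'E phiK.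
  split.
  - by move=> c; rewrite /e' /= lrmorph_alg eC map_polyC /= lrmorph_alg.
  - move=> b; rewrite /e' /= horner_coef0 coef_map -horner_coef0 e0.
    exact: psiK.
  - move=> b; rewrite /e' /=; set q := e _.
    have -> : map_poly (map_poly phi \o e \o psi) (map_poly phi q) =
        map_poly (map_poly phi) (map_poly e q).
      rewrite -!map_poly_comp; apply: eq_map_poly => x /=.
      by rewrite phiK.
    rewrite /q eD map_comp_poly rmorphD /= map_polyX map_polyC /= map_polyX.
    congr (_ \Po _); rewrite -!map_poly_comp; apply: eq_map_poly => x /=.
    by rewrite map_polyC.
case: e_proper => _ eT; split=> // e'T; apply: eT => b _.
by have := e'T (phi b) I; rewrite /exp_inv /= e'E phiK.
Qed.

End Subalgebras.

(** * The algebra A of the theorem, with its subalgebras B and E *)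

Section Quotient.
Variables (k : fieldType) (m : nat) (r : 'I_m -> nat).
Hypothesis hr : forall i, (0 < r i)%N.
Local Notation P := {mpoly k[m + 2]}.
Variable F : P.
Hypothesis F0 : killXs F != 0.
Variables (A : comAlgType k) (pi : {lrmorphism {mpoly k[(m + 2).+1]} -> A}).
Hypothesis hA : is_quotient (relator r F) pi.
Local Notation im := (im pi).
Local Notation y := (pi 'X_ord_max).
Local Notation M := (Xpow k r).
Local Notation rel := (M%:P * 'X - F%:P).
Local Notation X j := (varX k j).

Lemma Xpow_split j : M = (\prod_(l | l != j) X l ^+ r l) * X j ^+ r j.
Proof. by rewrite /Xpow (bigD1 j) //= mulrC. Qed.

Lemma varX_divides_Xpow j : divides (X j) M.
Proof.
rewrite (Xpow_split j) -(prednK (hr j)) exprS mulrCA.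
by apply: divides_mulr; exists 1; rewrite mul1r.
Qed.

Lemma Xpow_neq0 : M != 0.
Proof. by apply/prodf_neq0 => i _; rewrite expf_neq0 // mpolyX_neq0. Qed.

Lemma ev_onto a : exists q, (map_poly im q).[y] = a.
Proof.
have [p <-] := hA.1 a; exists (muni p).
by rewrite -pi_horner horner_muni.
Qed.

Lemma ev_eq0 q : (map_poly im q).[y] = 0 <-> exists q', q = q' * rel.
Proof.
have muni_rel : muni (relator r F) = rel.
  by rewrite /relator muniB muniM !muni_mwiden muniX_max.
rewrite -pi_horner (hA.2 _); split=> -[p pE].
  by exists (muni p); rewrite -muni_rel -rmorphM -pE /= muni_horner.
exists (map_poly (@mwiden (m + 2) k) p).['X_ord_max].
by rewrite -[RHS]horner_muni muniM muni_horner muni_rel -pE.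
Qed.

Lemma im_Xpow_y : im M * y = im F.
Proof. exact: (im_rel ev_eq0). Qed.

Lemma im_injective : injective im.
Proof. exact: (im_inj Xpow_neq0 ev_eq0). Qed.

Lemma im_dvd b c a : im b = im c * a -> exists u v, b = u * c + v * F.
Proof. exact: (im_divides ev_onto ev_eq0). Qed.

Lemma varX_regular j a : im (X j) * a = 0 -> a = 0.
Proof.
apply: (im_prime_regular ev_onto ev_eq0 (primeX _ _) (varX_ndivides F0)).
exact: varX_divides_Xpow.
Qed.

Lemma im_dvd_square j b a : im b = im (X j ^+ (r j).+1) * a ->
  exists u v, (\prod_(l | l != j) X l ^+ r l) * b = u * X j + v * F ^+ 2.
Proof.
exact: (im_divides_square ev_onto ev_eq0 (Xpow_split j) (primeX _ _)
  (varX_ndivides F0)).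
Qed.

Lemma im_Xpow : im M = \prod_i im (X i) ^+ r i.
Proof. by rewrite /Xpow rmorph_prod /=; apply: eq_bigr => i _; rewrite rmorphXn. Qed.

Lemma Xpow_regular a : im M * a = 0 -> a = 0.
Proof.
rewrite im_Xpow; move: a; apply: (big_ind (fun x => forall a, x * a = 0 -> a = 0)).
- by move=> a; rewrite mul1r.
- by move=> p q IHp IHq a; rewrite -mulrA => /IHp/IHq.
- move=> i _; elim: (r i) => [|n IHn] a; first by rewrite mul1r.
  by rewrite exprS -mulrA => /varX_regular/IHn.
Qed.

Lemma exists_denominator a : exists n b, im M ^+ n * a = im b.
Proof. exact: (clear_denominators ev_onto ev_eq0). Qed.

Lemma subB_im a : subB pi a <-> exists p, a = im p.
Proof.
split=> [|[p ->]].
  apply: (smallest_sub (X := [set a | exists p, a = im p])); last first.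
    by move=> b [[i _ <-]|[->|->]] /=; eexists.
  apply/subalg_closedE; split=> [|c u v [p ->] [q ->]|u v [p ->] [q ->]].
  - by exists 1; rewrite rmorph1.
  - by exists (c%:MP * p + q); rewrite rmorphD rmorphM /= imC -scalerAl mul1r.
  - by exists (p * q); rewrite rmorphM.
apply: (gen_subalg_rmorph (f := im)) => [c|]; first exact: imC.
apply: ord_split_ind => i; apply: sub_gen_smallest; first by left; exists i.
by right; case: i => -[|[|//]] ilt; [left|right]; rewrite /= ?/varZ ?/varT;
  congr (im 'X_(rshift m _)); apply: val_inj.
Qed.

Lemma subE_im a : subE pi a <-> exists p, killZT p = p /\ a = im p.
Proof.
split=> [|[p [<- ->]]].
  apply: (smallest_sub (X := [set a | exists p, killZT p = p /\ a = im p])); last first.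
    by move=> b [i _ <-] /=; exists (X i); rewrite killZT_varX.
  apply/subalg_closedE.
  split=> [|c u v [p [pE ->]] [q [qE ->]]|u v [p [pE ->]] [q [qE ->]]].
  - by exists 1; rewrite !rmorph1.
  - exists (c%:MP * p + q); split.
      by rewrite rmorphD rmorphM /= pE qE /killZT comp_mpolyC.
    by rewrite rmorphD rmorphM /= imC -scalerAl mul1r.
  - by exists (p * q); rewrite !rmorphM /= pE qE.
move: p; apply: (gen_subalg_rmorph (f := im \o @killZT k m)) => [c|] /=.
  by rewrite /killZT comp_mpolyC imC.
have [_ gD _] := (subalg_closedE _).1 (gen_subalg_closed (range (fun i => im (X i)))).
apply: ord_split_ind => i; rewrite -?/(X i).
  by rewrite killZT_varX; apply: sub_gen_smallest; exists i.
have [g1 _ _] := (subalg_closedE _).1 (gen_subalg_closed (range (fun i => im (X i)))).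
by rewrite killZT_rshift rmorph0 -(subrr 1) addrC -scaleN1r; apply: gD.
Qed.

(** * An exponential map on A that fixes E *)

Definition shiftZ (p : P) : {poly A} :=
  mmap (polyC \o in_alg A)
    (fun i => (im 'X_i)%:P + (if i == rshift m ord0 then (im M)%:P * 'X else 0)) p.
HB.instance Definition _ := GRing.RMorphism.copy shiftZ shiftZ.

Lemma shiftZC c : shiftZ c%:MP = (c%:A)%:P.
Proof. by rewrite /shiftZ mmapC. Qed.

Lemma shiftZX i : shiftZ 'X_i =
  (im 'X_i)%:P + (if i == rshift m ord0 then (im M)%:P * 'X else 0).
Proof. by rewrite /shiftZ mmapX mmap1U. Qed.

Lemma shiftZ_killZT p : shiftZ (killZT p) = (im (killZT p))%:P.
Proof.
move: p; apply: (mpoly_rmorph_ext (f := shiftZ \o @killZT k m)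
                                  (g := polyC \o im \o @killZT k m)).
  by move=> c /=; rewrite /killZT comp_mpolyC shiftZC imC.
apply: ord_split_ind => i /=; rewrite -?/(X i).
  by rewrite killZT_varX shiftZX eq_lrshift addr0.
by rewrite killZT_rshift !rmorph0.
Qed.

(** A first-order Taylor expansion. For [p := F] the correction is divisible by x^r, which allows
    the shift to extend to [y]. *)
Lemma shiftZ_mod p : exists g, shiftZ p = (im p)%:P + (im M)%:P * 'X * g.
Proof.
elim/mpoly_ring_ind: p => [c|i|p q [u uE] [v vE]|p q [u uE] [v vE]].
- by exists 0; rewrite shiftZC imC mulr0 addr0.
- rewrite shiftZX; case: eqP => _; first by exists 1; rewrite mulr1.
  by exists 0; rewrite mulr0.
- exists (u + v); rewrite rmorphD /= uE vE !rmorphD /=.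
  by move: (im p)%:P (im q)%:P ((im M)%:P * 'X) => a b t; ring.
- exists (u * (im q)%:P + (im p)%:P * v + (im M)%:P * 'X * (u * v)).
  rewrite rmorphM /= uE vE !rmorphM /=.
  by move: (im p)%:P (im q)%:P ((im M)%:P * 'X) => a b t; ring.
Qed.

Lemma killZT_Xpow : killZT M = M.
Proof.
rewrite rmorph_prod /=; apply: eq_bigr => i _.
by rewrite rmorphXn /= killZT_varX.
Qed.

(* The exponential map z |-> z + x^r U, t |-> t over E. *)
Lemma exists_shift : exists e : {rmorphism A -> {poly A}},
  [/\ exponential e, exp_inv e `<` setT
    & forall p, killZT p = p -> e (im p) = (im p)%:P].
Proof.
have [g gE] := shiftZ_mod F.
have shiftM : shiftZ M = (im M)%:P by rewrite -killZT_Xpow shiftZ_killZT.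
(* The image of [y] is forced: F goes to F + x^r U g = x^r (y + U g). *)
have [|e eE] := @rmorph_factor _ _ _ im y rel ev_onto ev_eq0 shiftZ (y%:P + 'X * g).
  rewrite rmorphB rmorphM /= !map_polyC map_polyX /= !hornerE.
  rewrite [shiftZ F]gE [shiftZ M]shiftM -im_Xpow_y rmorphM; ring.
have {}eE p : e (im p) = shiftZ p := eE p.
have eM : e (im M) = (im M)%:P by rewrite eE.
exists e; split; last by move=> p pE; rewrite eE -pE shiftZ_killZT.
- split.
  + by move=> c; rewrite -(imC pi) eE shiftZC imC.
  + apply: (rmorph_ext_im ev_onto ev_eq0 (f := horner_eval 0 \o e) (g := idfun)).
      by move=> c /=; rewrite eM /horner_eval hornerC; apply: Xpow_regular.
    apply: (mpoly_rmorph_ext (f := horner_eval 0 \o e \o im) (g := im)).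
      by move=> c /=; rewrite eE shiftZC /horner_eval hornerC imC.
    by move=> i /=; rewrite eE shiftZX /horner_eval; case: eqP => _; rewrite !hornerE.
  + apply: (rmorph_ext_im ev_onto ev_eq0 (f := map_poly e \o e)
      (g := comp_poly ('X + 'X%:P) \o map_poly polyC \o e)).
      move=> c /=; rewrite eM map_polyC /= eM.
      by do 2!apply: polyC_regular; apply: Xpow_regular.
    apply: (mpoly_rmorph_ext (f := map_poly e \o e \o im)
      (g := comp_poly ('X + 'X%:P) \o map_poly polyC \o e \o im)).
      move=> c /=; rewrite eE shiftZC !map_polyC /= comp_polyC.
      by rewrite -(imC pi) eE shiftZC imC.
    move=> i /=; rewrite eE shiftZX !rmorphD /= !map_polyC /= comp_polyC eE shiftZX.
    case: eqP => _; last by rewrite !rmorph0 !addr0.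
    rewrite !rmorphM /= !map_polyC !map_polyX /= eM comp_polyC comp_polyX.
    by rewrite rmorphD rmorphM /= mulrDr [_ * 'X + _]addrC addrA.
(* z is not invariant, since the coefficient of U in its image is the nonzero element x^r. *)
- split=> // /(_ (im 'X_(rshift m ord0)) I); rewrite /exp_inv /= eE shiftZX eqxx.
  move=> /(congr1 (coefp 1)) /=; rewrite coefD !coefC /= add0r coefCM coefX mulr1.
  by rewrite -(rmorph0 im) => /im_injective /eqP; rewrite (negPf Xpow_neq0).
Qed.

Hypothesis hDK : @Derksen k A = subB pi.

(* Otherwise F mod X_j, divided by x_j, is an element of A \ B invariant under
   the exponential map above. *)
Lemma killX_F_ZT j : killZT (kill_varX j F) <> kill_varX j F.
Proof.
move=> FE; have [g FgE] := kill_modX (lshift 2 j) F.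
rewrite -/(kill_varX j F) -/(X j) in FgE.
have [M' M'E] := varX_divides_Xpow j.
(* Since x_j [M'] y = F = (F mod X_j) + [g] x_j, this [u] is the quotient of F mod X_j by x_j. *)
pose u := im M' * y - im g.
have uE : im (X j) * u = im (kill_varX j F).
  have -> : kill_varX j F = F - g * X j by rewrite {2}FgE addrK.
  rewrite rmorphB rmorphM /= -im_Xpow_y M'E rmorphM /u; ring.
have [e [e_exp e_proper e_inv]] := exists_shift.
have : Derksen u.
  apply: sub_gen_smallest; exists e; split=> //; rewrite /exp_inv /=.
  apply/eqP; rewrite -subr_eq0; apply/eqP.
  apply: (polyC_regular (@varX_regular j)).
  rewrite mulrBr -rmorphM /= uE -(e_inv (X j)) ?killZT_varX //.
  by rewrite -rmorphM /= uE e_inv // subrr.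
(* If [u] were in B, then X_j would divide F mod X_j, which would have to vanish. *)
rewrite hDK => /subB_im[p pE].
move: uE; rewrite pE -rmorphM => /im_injective /(congr1 (kill_varX j)).
rewrite rmorphM /= killX_varX eqxx mul0r => /esym kkF.
by move/eqP: kkF; apply/negP/killX_neq0; rewrite killXs_killX.
Qed.

(** * Restrictions to B, viewed as endomorphisms of k[X, Z, T] *)

Definition lifts (T : P -> P) (phi : A -> A) := forall p, im (T p) = phi (im p).

(** As [im] is injective with image B, it transports the restriction of [phi] to the polynomial
    ring, where divisibility arguments apply. *)
Lemma exists_lift (phi : {lrmorphism A -> A}) :
  (forall a, subB pi a -> subB pi (phi a)) ->
  exists T : {rmorphism P -> P}, lifts T phi.
Proof.
move=> phiB; have /choice[T TE] p : exists q, im q = phi (im p).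
  have /phiB/subB_im[q ->] : subB pi (im p) by apply/subB_im; exists p.
  by exists q.
have [||| T' T'E] := @rmorphism_of P P T.
- by move=> p q; apply: im_injective; rewrite TE !rmorphB /= !TE.
- by apply: im_injective; rewrite TE !rmorph1.
- by move=> p q; apply: im_injective; rewrite TE !rmorphM /= !TE.
by exists T' => p; rewrite T'E.
Qed.

Lemma liftC T (phi : {lrmorphism A -> A}) c : lifts T phi -> T c%:MP = c%:MP.
Proof. by move=> TE; apply: im_injective; rewrite TE imC lrmorph_alg. Qed.

Lemma lift_cancel T T' phi psi :
  lifts T phi -> lifts T' psi -> cancel phi psi -> cancel T T'.
Proof. by move=> TE T'E phiK p; apply: im_injective; rewrite T'E TE. Qed.

Lemma lift_relation (T : {rmorphism P -> P}) (phi : {lrmorphism A -> A}) :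
  lifts T phi -> im (T F) = im (T M) * phi y.
Proof. by move=> TE; rewrite !TE -rmorphM /= im_Xpow_y. Qed.

Lemma prime_divides_Xpow p : prime_elt p -> divides p M ->
  exists j, exists2 c, c != 0 & p = c%:MP * X j.
Proof.
move=> pp /(prime_dvd_prod pp)[j /(prime_dvd_prime pp (primeX _ _))].
by case=> u /divides1_mpoly[c c0 ->] pE; exists j, c.
Qed.

Lemma lift_varX (T : {rmorphism P -> P}) (phi : {lrmorphism A -> A}) i :
  lifts T phi -> bijective T ->
  exists j, exists2 c, c != 0 & T (X i) = c%:MP * X j.
Proof.
move=> TE Tbij; have TXp := prime_elt_bij Tbij (primeX k (lshift 2 i)).
apply: prime_divides_Xpow => //.
have [n [b bE]] := exists_denominator (phi y).
(* The prime [T (X i)] divides [T M], hence [T F * M ^+ n]. It does not divide [T F], since X_i does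
   not divide F, so it divides [M]. *)
have TFE : T F * M ^+ n = T M * b.
  apply: im_injective; rewrite !(rmorphM im) rmorphXn /= -bE.
  by rewrite (lift_relation TE) mulrAC mulrA.
have [c ME] := varX_divides_Xpow i.
have [_ _ TXM] := TXp.
have [|[d dE]|/(prime_dvd_exp TXp)//] := TXM (T F) (M ^+ n).
  by exists (T c * b); rewrite TFE ME rmorphM mulrAC.
case: (varX_ndivides (j := i) F0).
case: Tbij => T' TK T'K; exists (T' d).
by apply: (can_inj TK); rewrite rmorphM /= T'K.
Qed.

Lemma lift_exponent (T T' : {rmorphism P -> P}) (phi psi : {lrmorphism A -> A})
    i j c : lifts T phi -> lifts T' psi -> cancel T T' -> cancel T' T ->
  c != 0 -> T (X i) = c%:MP * X j -> (r i <= r j)%N.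
Proof.
move=> TE T'E TK T'K c0 TXE; rewrite leqNgt; apply/negP => rij.
have T'XE : T' (X j) = c^-1%:MP * X i.
  rewrite -[X i in RHS]TK TXE rmorphM /= (liftC _ T'E) mulrA -mpolyCM mulVf //.
  by rewrite mpolyC1 mul1r.
(* In A, [T' F] is [T' M] times [psi y], and [T' M] is a multiple of [T' (X j)], hence of X_i. *)
have [u1 [v1 E1]] : exists u v, T' F = u * X i + v * F.
  have [d ME] := varX_divides_Xpow j.
  apply: (@im_dvd _ _ (im (T' d * c^-1%:MP) * psi y)).
  rewrite (lift_relation T'E) mulrA -rmorphM /= ME rmorphM /= T'XE.
  by congr (im _ * _); ring.
set w := \prod_(l | l != j) X l ^+ r l.
(* As [r j < r i], [T M] is a multiple of X_j to the power [(r j).+1], one more than occurs in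
   [M]. *)
have [u2 [v2 E2]] : exists u v, w * T F = u * X j + v * F ^+ 2.
  apply: (@im_dvd_square _ _
    (im (T (\prod_(l | l != i) X l ^+ r l * X i ^+ (r i - (r j).+1))
         * c%:MP ^+ (r j).+1) * phi y)).
  rewrite (lift_relation TE) mulrA -rmorphM /= (Xpow_split i).
  rewrite -{1}(subnK rij) exprD mulrA rmorphM /= (rmorphXn T) /= TXE exprMn.
  move: (T (_ * _)) (c%:MP ^+ _) (X j ^+ _) => a b d.
  by rewrite mulrA [d * _]mulrC.
(* Apply [T] to [E1], multiply by [w] and substitute [E2]. *)
have wE : w * F = (w * T u1 * c%:MP + T v1 * u2) * X j + (T v1 * v2) * F ^+ 2.
  rewrite -{1}(T'K F) E1 rmorphD !rmorphM /= TXE mulrDr [w * (T v1 * _)]mulrCA E2.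
  by move: (T u1) (T v1) (c%:MP) => a b d; ring.
have kw : kill_varX j w = w.
  rewrite rmorph_prod; apply: eq_bigr => l /negPf lj.
  by rewrite rmorphXn /= killX_varX lj.
have wF : w = kill_varX j (T v1 * v2) * kill_varX j F.
  apply: (mulIf (killX_neq0 j F0)); rewrite -[in LHS]kw -rmorphM wE.
  by rewrite rmorphD !rmorphM /= killX_varX eqxx mulr0 add0r mulrA.
(* No X_l divides F mod X_j, so the primes in [w] can be removed; F mod X_j then divides 1 and is a
   constant, contrary to [killX_F_ZT]. *)
have : divides (kill_varX j F) (w * 1) by rewrite mulr1; eexists; exact: wF.
move=> /(prod_primes_cancel _)-/(_ _)/divides1_mpoly[].
  move=> l _; split; first exact: primeX.
  by apply: varX_ndivides; rewrite killXs_killX.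
by move=> d _ FE; apply: (@killX_F_ZT j); rewrite FE /killZT comp_mpolyC.
Qed.

(** * The ideal I and the direct part *)

Lemma im_combination u v : im (u * M + v * F) = im M * (im u + im v * y).
Proof.
rewrite rmorphD !rmorphM /= -im_Xpow_y mulrDr [im M * im u]mulrC.
by rewrite [im v * _]mulrCA.
Qed.

Lemma idI_im a : idI pi r F a <-> exists u v, a = im (u * M + v * F).
Proof.
rewrite /idI -im_Xpow; split.
  move=> [_ [_ [/subB_im[u ->] /subB_im[v ->] ->]]]; exists u, v.
  by rewrite rmorphD !rmorphM.
move=> [u [v ->]]; exists (im u), (im v); split.
- by apply/subB_im; exists u.
- by apply/subB_im; exists v.
- by rewrite rmorphD !rmorphM.
Qed.

(** Only inclusions are asserted; applied to [phi] and to its inverse, they give the bijections on E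
    and B and the equality for I. *)
Lemma automorphism_half (phi psi : {lrmorphism A -> A}) :
  cancel phi psi -> cancel psi phi ->
  [/\ condB pi r phi, forall a, subB pi a -> subB pi (phi a),
      forall a, subE pi a -> subE pi (phi a)
    & forall a, idI pi r F a -> idI pi r F (phi a)].
Proof.
move=> phiK psiK.
have phiB a : subB pi a -> subB pi (phi a).
  by rewrite -hDK; apply: (Derksen_automorphism phiK psiK).
have psiB a : subB pi a -> subB pi (psi a).
  by rewrite -hDK; apply: (Derksen_automorphism psiK phiK).
have [T TE] := exists_lift phiB; have [T' T'E] := exists_lift psiB.
have TK : cancel T T' := lift_cancel TE T'E phiK.
have T'K : cancel T' T := lift_cancel T'E TE psiK.
have /choice[s] i : exists jc : 'I_m * k,
    [/\ jc.2 != 0, T (X i) = jc.2%:MP * X jc.1 & r i = r jc.1].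
  have [j [c c0 TXE]] := lift_varX i TE (Bijective TK T'K).
  (* The two inequalities between exponents come from [phi] and from its inverse. *)
  exists (j, c); split=> //; apply/eqP; rewrite eqn_leq.
  rewrite (lift_exponent TE T'E TK T'K c0 TXE) /=.
  apply: (lift_exponent (c := c^-1) T'E TE T'K TK); first by rewrite invr_eq0.
  rewrite -[X i]TK TXE rmorphM /= (liftC _ T'E) mulrA -mpolyCM mulVf //.
  by rewrite mpolyC1 mul1r.
move=> sE.
have phiX i : phi (im (X i)) = (s i).2 *: im (X (s i).1).
  have [_ TXE _] := sE i.
  by rewrite -TE TXE rmorphM /= imC -scalerAl mul1r.
have s_inj : injective (fun i => (s i).1).
  move=> i i' sii'; have [c0 TXE _] := sE i; have [c0' TXE' _] := sE i'.
  apply: (@lshift_inj m 2); apply: (@dividesXX k).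
  exists ((s i').2 / (s i).2)%:MP; rewrite -/(X i) -/(X i').
  apply: (can_inj TK); rewrite rmorphM /= (liftC _ TE) TXE TXE' sii' mulrA.
  by rewrite -mpolyCM divfK.
(* The injective index map is a permutation preserving the exponents, so reindexing recovers [M] up
   to a constant. *)
have TM : T M = (\prod_i (s i).2 ^+ r i)%:MP * M.
  have ME : M = \prod_i X (s i).1 ^+ r (s i).1 by rewrite /Xpow (reindex_inj s_inj).
  rewrite [W in _ = _ * W]ME [LHS]rmorph_prod /= [W in _ = W * _]rmorph_prod.
  rewrite -big_split /=; apply: eq_bigr => i _; have [_ TXE rE] := sE i.
  by rewrite [LHS]rmorphXn [T _]TXE exprMn -rE [in RHS]rmorphXn.
split=> //.
- by move=> i; exists (s i).1, (s i).2; have [c0 _ ri] := sE i.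
- apply: gen_subalg_map => _ [i _ <-]; rewrite /= phiX.
  apply/subE_im; exists ((s i).2%:MP * X (s i).1).
  rewrite rmorphM /= killZT_varX /killZT comp_mpolyC; split=> //.
  by rewrite rmorphM /= imC -scalerAl mul1r.
- move=> _ /idI_im[u [v ->]]; rewrite -TE.
  (* Elements of I are multiples of x^r in A, and [phi] fixes x^r up to a constant; by [im_dvd],
     multiples of x^r that lie in B are in I. *)
  have [u' [v' E]] : exists u' v', T (u * M + v * F) = u' * M + v' * F.
    apply: (@im_dvd _ _ (im (\prod_i (s i).2 ^+ r i)%:MP * phi (im u + im v * y))).
    rewrite TE im_combination rmorphM /= -[phi (im M)]TE.
    by rewrite TM rmorphM /= mulrCA mulrA.
  by apply/idI_im; exists u', v'; rewrite E.
Qed.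

(** * The intersection of I with E, and the converse *)

Lemma killZT_ideal p u v : killZT p = p -> p = u * M + v * F ->
  exists2 e, killZT e = e & p = e * M.
Proof.
(* This property of [c] is stable under products, so it passes from the variables to [M]. For [M] it
   makes [p] a multiple of [M], and cancelling [M] puts the cofactor in k[X]. *)
pose K (c : P) := [/\ killZT c = c, c != 0 & forall p u v,
  killZT p = p -> p = u * c + v * F -> divides c v].
have K1 : K 1.
  by split=> [||p' u' v' _ _]; rewrite ?rmorph1 ?oner_neq0 //; exists v'; rewrite mulr1.
have KM c d : K c -> K d -> K (c * d).
  move=> [cE c0 Kc] [dE d0 Kd]; split; rewrite ?mulf_neq0 ?rmorphM /= ?cE ?dE //.
  move=> p' u' v' pE; rewrite mulrA mulrAC => puv.
  have [v1 vE] := Kc _ _ _ pE puv.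
  have puv' : p' = c * (u' * d + v1 * F) by rewrite puv vE; ring.
  have [||v2 v2E] := Kd (u' * d + v1 * F) u' v1 => //.
    by apply: (mulfI c0); rewrite -{1}cE -rmorphM -puv'.
  by exists v2; rewrite vE v2E mulrAC mulrA.
have KX i : K (X i).
  split; [exact: killZT_varX|exact: mpolyX_neq0|move=> p' u' v' pE puv].
  apply/dividesX; rewrite -/(kill_varX i v').
  have kpE : kill_varX i p' = kill_varX i v' * kill_varX i F.
    by rewrite puv rmorphD !rmorphM /= killX_varX eqxx mulr0 add0r.
  (* Otherwise F mod X_i is a factor of the nonzero element [p'] mod X_i of k[X], and so lies in
     k[X] itself. *)
  apply/eqP/negPn/negP => v0; apply: (@killX_F_ZT i).
  apply: (killZT_factor (p := kill_varX i v')).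
    by rewrite mulf_neq0 // killX_neq0.
  by rewrite -kpE killZT_killX pE.
move=> pE puv; have [_ M0 /(_ _ _ _ pE puv)[w vE]] : K M.
  rewrite /Xpow; apply: (big_ind K) => // i _.
  by elim: (r i) => [|n IHn]; rewrite ?expr0 // exprS; apply: KM.
have pE' : p = (u + w * F) * M by rewrite puv vE; ring.
exists (u + w * F) => //; apply: (mulIf M0).
by rewrite -{1}killZT_Xpow -rmorphM -pE'.
Qed.

Lemma automorphism_of_restrictions (phi : {lrmorphism A -> A}) :
  condA pi phi -> condC pi r F phi -> bijective phi.
Proof.
move=> [[phiE _ surjE] [phiB injB surjB]] phiI.
have imB p : subB pi (im p) by apply/subB_im; exists p.
have [T TE] := exists_lift phiB.
have phi_inj_im p q : phi (im p) = phi (im q) -> p = q.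
  by move=> pq; apply/im_injective/injB => //; apply/mem_set.
have MI : idI pi r F (im M) by apply/idI_im; exists 1, 0; rewrite mul1r mul0r addr0.
have FI : idI pi r F (im F) by apply/idI_im; exists 0, 1; rewrite mul1r mul0r add0r.
have ME : subE pi (im M) by apply/subE_im; exists M; rewrite killZT_Xpow.
(* The image of x^r lies in both E and I. Surjectivity on E and I gives the reverse divisibility, so
   [g] is a unit with inverse [T e]. *)
have [g gE] : exists g, T M = g * M.
  have /subE_im[p [pE TMp]] := phiE _ ME.
  have : idI pi r F (phi (im M)) by rewrite -phiI; exists (im M).
  move=> /idI_im[u [v puv]]; move: puv TMp; rewrite -TE.
  move=> /im_injective puv /im_injective TMp.
  by have [g _ TME] := killZT_ideal pE (etrans (esym TMp) puv); exists g; rewrite TMp.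
have [e eE] : exists e, M = T e * T M.
  have [_ /subE_im[p [pE ->]] Mp] := surjE _ ME.
  have : (phi @` idI pi r F) (im M) by rewrite phiI.
  case=> _ /idI_im[u [v ->]]; rewrite -Mp => /phi_inj_im puv.
  have [e _ ep] := killZT_ideal pE (esym puv).
  by exists e; apply: im_injective; rewrite -rmorphM -ep TE.
have ge1 : T e * g = 1.
  by apply: (mulIf Xpow_neq0); rewrite mul1r -mulrA -gE -eE.
have TeK a : im (T e) * (im g * a) = a by rewrite mulrA -rmorphM ge1 rmorph1 mul1r.
have phiM : phi (im M) = im g * im M by rewrite -TE gE rmorphM.
have imphi p : exists a, phi a = im p by have [a] := surjB _ (imB p); exists a.
(* F is in [phi] of I, so x^r y = F = [g] x^r [phi a] for some [a] in A. Cancelling x^r gives y =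
   [g * phi a], and [g] lies in B, the image of B under [phi]. *)
have [y' y'E] : exists y', phi y' = y.
  move: FI; rewrite -phiI => -[_ /idI_im[u [v ->]]].
  rewrite im_combination rmorphM /= phiM -im_Xpow_y; set a := _ + _ => ME'.
  have [g' g'E] := imphi g; exists (g' * a); apply/eqP; rewrite -subr_eq0.
  apply/eqP/Xpow_regular; rewrite mulrBr -ME' rmorphM /= g'E.
  by rewrite mulrCA mulrA subrr.
have phi_surj a : exists b, phi b = a.
  have [q <-] := ev_onto a; elim/poly_ind: q => [|q c [b bE]].
    by exists 0; rewrite !rmorph0 horner0.
  have [d dE] := imphi c; exists (b * y' + d).
  by rewrite rmorphD rmorphM /= bE y'E dE rmorphD rmorphM /= map_polyX map_polyC !hornerE.
have phi_inj : injective phi.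
  move=> a a' aa'; apply/eqP; rewrite -subr_eq0; apply/eqP.
  have : phi (a - a') = 0 by rewrite rmorphB /= aa' subrr.
  (* A kernel element times a power of x^r is a kernel element in B, hence zero, and x^r is
     regular. *)
  move: (a - a') => b b0; have [n [c cE]] := exists_denominator b.
  have c0 : c = 0.
    by apply: phi_inj_im; rewrite -cE rmorphM /= b0 mulr0 !rmorph0.
  move: cE; rewrite c0 rmorph0; elim: n => [|n IHn]; first by rewrite mul1r.
  by rewrite exprS -mulrA => /Xpow_regular/IHn.
have [psi psiE] := choice phi_surj.
by exists psi => // a; apply: phi_inj; rewrite psiE.
Qed.

End Quotient.

(** * Inverse automorphisms and the two directions of the theorem *)

Lemma lrmorph_inverse (k : fieldType) (A : comAlgType k) (phi : {lrmorphism A -> A}) :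
  bijective phi ->
  exists psi : {lrmorphism A -> A}, cancel phi psi /\ cancel psi phi.
Proof.
case=> psi phiK psiK.
have psiZ : linear psi.
  by move=> c u v; apply: (can_inj phiK); rewrite linearP /= !psiK.
have psiM : monoid_morphism psi.
  split; first by apply: (can_inj phiK); rewrite psiK rmorph1.
  by move=> u v; apply: (can_inj phiK); rewrite rmorphM /= !psiK.
pose psi' : {lrmorphism A -> A} := HB.pack psi
  (GRing.isLinear.Build k A A *:%R psi psiZ)
  (GRing.isMonoidMorphism.Build A A psi psiM).
by exists psi'.
Qed.

Lemma set_bij_inverse (T : Type) (S : set T) (f g : T -> T) :
  cancel f g -> cancel g f ->
  (forall a, S a -> S (f a)) -> (forall a, S a -> S (g a)) -> set_bij S S f.
Proof.
move=> fK gK fS gS; split=> //; first by move=> a b _ _ /(can_inj fK).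
by move=> a Sa; exists (g a); [apply: gS|rewrite gK].
Qed.

Theorem theorem4p2 (k : fieldType) (m : nat) (hm : (1 <= m)%N)
    (r : 'I_m -> nat) (hr : forall i, (1 < r i)%N)
    (f : {mpoly k[2]}) (hf : f != 0)
    (h : {mpoly k[m + 2]}) (hh : in_idealX h)
    (F : {mpoly k[m + 2]}) (hF : F = ZTpoly m f + h)
    (A : comAlgType k) (pi : {lrmorphism {mpoly k[(m + 2).+1]} -> A})
    (hA : is_quotient (relator r F) pi)
    (hDK : @Derksen k A = subB pi) :
  (forall phi : {lrmorphism A -> A}, bijective phi ->
     [/\ condA pi phi, condB pi r phi & condC pi r F phi]) /\
  (forall phi : {lrmorphism A -> A}, condA pi phi -> condC pi r F phi ->
     condB pi r phi /\ bijective phi).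
Proof.
have F0 : killXs F != 0 by rewrite (killXs_F hh hF).
have r0 i : (0 < r i)%N by apply: ltnW.
have half := automorphism_half r0 F0 hA hDK.
split=> phi.
  move=> /lrmorph_inverse[psi [phiK psiK]].
  have [bphi Bphi Ephi Iphi] := half _ _ phiK psiK.
  have [_ Bpsi Epsi Ipsi] := half _ _ psiK phiK.
  split=> //; first by split; apply: (set_bij_inverse phiK psiK).
  apply/seteqP; split=> [_ [a Ia <-]|a Ia]; first exact: Iphi.
  by exists (psi a); [apply: Ipsi|rewrite psiK].
move=> Aphi Cphi; have phi_bij := automorphism_of_restrictions r0 F0 hA hDK Aphi Cphi.
split=> //; have [psi [phiK psiK]] := lrmorph_inverse phi_bij.
by have [] := half _ _ phiK psiK.
Qed.
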